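(* The tetrahedron $\Delta$ is a strict local maximizer for lattice width (with respect to $\Lambda$) among tetrahedra that are hollow with respect to $\Lambda$. That is, there exists $\varepsilon>0$ such that for every tetrahedron $\Delta'=\operatorname{conv}(a_1',a_2',a_3',a_4')\subset\mathbb{R}^3$ with $\|a_i'-a_i\|<\varepsilon$ for all $i\in\{1,2,3,4\}$ and $\Delta'\neq\Delta$, either $\Delta'$ is not hollow with respect to $\Lambda$, or $\operatorname{width}_\Lambda(\Delta')<2+\sqrt2=\operatorname{width}_\Lambda(\Delta)$.
   Context: $\Delta=\operatorname{conv}(a_1,a_2,a_3,a_4)\subset\mathbb{R}^3$ with $a_1=(2+\sqrt2,\ \sqrt2,\ 2+\sqrt2)$, $a_2=(-\sqrt2,\ 2+\sqrt2,\ -2-\sqrt2)$, $a_3=(-2-\sqrt2,\ -\sqrt2,\ 2+\sqrt2)$, $a_4=(\sqrt2,\ -2-\sqrt2,\ -2-\sqrt2)$. $\Lambda=\{(a,b,c): a,b,c\in 1+2\mathbb{Z},\ a+b+c\in 1+4\mathbb{Z}\}$, an affine lattice. For an affine lattice $\Lambda$, let $\vec\Lambda=\Lambda-\Lambda$ be the associated linear lattice and $\vec\Lambda^*$ its dual lattice (linear functionals taking integer values on $\vec\Lambda$). A convex body $K\subset\mathbb{R}^3$ is hollow with respect to $\Lambda$ if $\Lambda$ does not intersect the interior of $K$. For a linear functional $f$, $\operatorname{width}(K,f)$ is the length of the segment $f(K)$, and $\operatorname{width}_\Lambda(K)$ is the minimum of $\operatorname{width}(K,f)$ over all nonzero $f\in\vec\Lambda^*$.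 The tetrahedron $\Delta$ is hollow with respect to $\Lambda$ and $\operatorname{width}_\Lambda(\Delta)=2+\sqrt2$. *)

(* Defs.v *)
From HB Require Import structures.
From mathcomp Require Import all_boot all_order all_algebra.
From mathcomp Require Import all_classical all_reals all_analysis.

Set Implicit Arguments.
Unset Strict Implicit.
Unset Printing Implicit Defensive.

Import Order.TTheory GRing.Theory Num.Theory.
Import numFieldNormedType.Exports.

Local Open Scope classical_set_scope.
Local Open Scope ring_scope.

Definition convex_hull (R : realType) (n m : nat) (a : 'I_m -> 'rV[R]_n) :
    set 'rV[R]_n :=
  [set x | exists w : 'I_m -> R,
    [/\ forall i, 0 <= w i, \sum_i w i = 1 & x = \sum_i w i *: a i]].

Definition affinely_independent (R : realType) (n m : nat)
    (a : 'I_m -> 'rV[R]_n) : Prop :=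
  forall w : 'I_m -> R,
    \sum_i w i = 0 -> \sum_i w i *: a i = 0 -> forall i, w i = 0.

(* [`|v|] on row vectors is the sup norm in the library. *)
Definition euclidean_norm (R : realType) (n : nat) (v : 'rV[R]_n) : R :=
  Num.sqrt (\sum_i v 0 i ^+ 2).

Definition direction_lattice (R : realType) (n : nat) (L : set 'rV[R]_n) :
    set 'rV[R]_n :=
  [set v | exists x y, [/\ L x, L y & v = x - y]].

Definition dual_lattice (R : realType) (n : nat) (M : set 'rV[R]_n) :
    set {scalar 'rV[R]_n} :=
  [set f | forall v, M v -> f v \is a Num.int].

Definition hollow (R : realType) (n : nat) (L K : set 'rV[R]_n) : Prop :=
  L `&` K° = set0.

Definition width (R : realType) (n : nat) (K : set 'rV[R]_n)
    (f : {scalar 'rV[R]_n}) : R :=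
  sup (f @` K) - inf (f @` K).

(* For a convex body [K] and an affine lattice [L] of full rank this infimum
   is attained, so it is the minimum of the widths. *)
Definition lattice_width (R : realType) (n : nat) (L K : set 'rV[R]_n) : R :=
  inf [set width K f | f in
    [set f : {scalar 'rV[R]_n} |
      dual_lattice (direction_lattice L) f /\ exists x, f x != 0]].

Definition point3 (R : realType) (x y z : R) : 'rV[R]_3 :=
  \row_(j < 3) [:: x; y; z]`_j.

Definition Lambda (R : realType) : set 'rV[R]_3 :=
  [set v | exists a b c : int,
    [/\ (a = 1 %[mod 2])%Z, (b = 1 %[mod 2])%Z, (c = 1 %[mod 2])%Z,
        (a + b + c = 1 %[mod 4])%Z
      & v = point3 a%:~R b%:~R c%:~R]].

Definition Delta_vertex (R : realType) (i : 'I_4) : 'rV[R]_3 :=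
  let s := Num.sqrt 2 : R in
  [:: point3 (2 + s) s (2 + s);
      point3 (- s) (2 + s) (- 2 - s);
      point3 (- 2 - s) (- s) (2 + s);
      point3 s (- 2 - s) (- 2 - s)]`_i.

Definition Delta (R : realType) : set 'rV[R]_3 := convex_hull (@Delta_vertex R).

Arguments Lambda R : clear implicits.
Arguments Delta_vertex R i : clear implicits.
Arguments Delta R : clear implicits.

(* Main.v *)
Require Import Defs.
From HB Require Import structures.
From mathcomp Require Import all_boot all_order all_algebra.
From mathcomp Require Import all_classical all_reals all_analysis.
From mathcomp Require Import zify ring lra.

Import Order.TTheory GRing.Theory Num.Theory.
Import numFieldNormedType.Exports.

Local Open Scope classical_set_scope.
Local Open Scope ring_scope.

(** Why the theorem is true.

    The rotation-reflection [rot : (x, y, z) |-> (-y, x, -z)] preserves the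
    affine lattice and permutes the vertices of the tetrahedron cyclically.  So
    every tetrahedron close to it is written [vertex b], where row [n] of the
    4 x 3 matrix [b] is the displacement of vertex number [n] rotated back to
    vertex number 0; the tetrahedron itself is [b = 0].

    Every facet contains exactly one lattice point, [facet_point n], and it lies
    in the relative interior of the facet.  For small [b] this point stays on the
    inner side of the three other facets, so a hollow [vertex b] must have it
    on or beyond facet [n]: [0 <= facet_slack b n], an oriented volume.  A
    functional that attains the width on a single pair of vertices still does
    for small [b], so that the width being at least [2 + sqrt 2] gives a linear
    inequality per functional: [0 <= diagonal_slack b n] for half of the
    first two coordinates, [0 <= side_slack b n] for the four functionals
    [(x +- y +- z) / 4] up to sign.  This is [near_slacks_ge0].

    These ten inequalities in twelve unknowns force [b = 0]
    ([slacks_ge0_trivial]), but only at second order.  Their gradients satisfy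
    one linear relation, whose coefficients are positive ([4 sqrt 2] on the
    diagonal, [4] on the side and [1] on the facet slacks, summed over [n]); so
    the weighted sum [L] of the slacks has no linear part.  In Fourier
    coordinates for the cyclic symmetry, its quadratic part is
    [- Q] plus products having a linear combination of slacks as a factor,
    where [Q] is positive definite in [y_0, z_a, z_b]; these three are
    coordinates on the common kernel of the ten gradients.  This is
    [slack_identity].  With [r] the size of [b] and [A] the sum of
    the slacks, this reads [A <= L <= - Q + O((A + r^2) r)], while inverting the
    linear parts gives [r = O(sqrt Q + A + r^2)] ([dominated_entries_gauge]).
    For small [r] these two estimates leave only [r = 0]
    ([absorb_small_radius]).

    That the width of the tetrahedron is [2 + sqrt 2] and that it is hollow are
    finite verifications once the dual lattice vectors, respectively the lattice
    points, have been confined to a bounded region. *)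

Set Implicit Arguments.
Unset Strict Implicit.
Unset Printing Implicit Defensive.

Section Simplices.
Variable R : realType.

(** * Widths of convex hulls *)

Lemma linear_convex_hull_le n m (a : 'I_m -> 'rV[R]_n) (f : {scalar 'rV[R]_n})
    (M : R) : (forall i, f (a i) <= M) -> forall x, convex_hull a x -> f x <= M.
Proof.
move=> aM x [w [w0 w1 ->]]; rewrite linear_sum /= -[M]mul1r -w1 mulr_suml.
by apply: ler_sum => i _; rewrite linearZ /= ler_wpM2l.
Qed.

Lemma linear_convex_hull_ge n m (a : 'I_m -> 'rV[R]_n) (f : {scalar 'rV[R]_n})
    (M : R) : (forall i, M <= f (a i)) -> forall x, convex_hull a x -> M <= f x.
Proof.
move=> aM x [w [w0 w1 ->]]; rewrite linear_sum /= -[M]mul1r -w1 mulr_suml.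
by apply: ler_sum => i _; rewrite linearZ /= ler_wpM2l.
Qed.

Lemma vertex_in_hull n m (a : 'I_m -> 'rV[R]_n) i : convex_hull a (a i).
Proof.
exists (fun j => (j == i)%:R); split => [j||]; first exact: ler0n.
  by rewrite (bigD1 i) //= eqxx big1 ?addr0 // => j /negPf ->.
rewrite (bigD1 i) //= eqxx scale1r big1 ?addr0 // => j /negPf ->.
by rewrite scale0r.
Qed.

Lemma width_convex_hull_ge n m (a : 'I_m -> 'rV[R]_n) (f : {scalar 'rV[R]_n})
    i j : f (a i) - f (a j) <= width (convex_hull a) f.
Proof.
rewrite /width; apply: lerB.
  apply: ub_le_sup; last by exists (a i) => //; exact: vertex_in_hull.
  exists (\sum_k `|f (a k)|) => _ [x ax <-].
  apply: linear_convex_hull_le ax => k.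
  by rewrite (bigD1 k) //= (le_trans (ler_norm _)) // lerDl sumr_ge0.
apply: ge_inf; last by exists (a j) => //; exact: vertex_in_hull.
exists (- \sum_k `|f (a k)|) => _ [x ax <-].
apply: linear_convex_hull_ge ax => k; rewrite lerNl.
by rewrite (bigD1 k) //= -normrN (le_trans (ler_norm _)) // lerDl sumr_ge0.
Qed.

Lemma width_convex_hullE n m (a : 'I_m -> 'rV[R]_n) (f : {scalar 'rV[R]_n})
    i j : (forall k, f (a j) <= f (a k) <= f (a i)) ->
  width (convex_hull a) f = f (a i) - f (a j).
Proof.
move=> aij; apply/eqP; rewrite eq_le width_convex_hull_ge andbT.
have ne : f @` convex_hull a !=set0.
  by exists (f (a i)); exists (a i) => //; exact: vertex_in_hull.
apply: lerB.
  apply: ge_sup => // _ [x ax <-].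
  by apply: linear_convex_hull_le ax => k; case/andP: (aij k).
apply: lb_le_inf => // _ [x ax <-].
by apply: linear_convex_hull_ge ax => k; case/andP: (aij k).
Qed.

Lemma lattice_width_le n m (L : set 'rV[R]_n) (a : 'I_m.+1 -> 'rV[R]_n)
    (f : {scalar 'rV[R]_n}) :
  dual_lattice (direction_lattice L) f -> (exists x, f x != 0) ->
  lattice_width L (convex_hull a) <= width (convex_hull a) f.
Proof.
move=> Lf f0; apply: ge_inf; last by exists f.
exists 0 => _ [g _ <-].
by rewrite (le_trans _ (width_convex_hull_ge a g 0 0)) // subrr.
Qed.

Definition dot3 (c v : 'rV[R]_3) : R :=
  c 0 0 * v 0 0 + c 0 1 * v 0 1 + c 0 2 * v 0 2.

Lemma dot3_linear c : linear_for *%R (dot3 c).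
Proof. by move=> k u v; rewrite /dot3 !mxE; ring. Qed.

HB.instance Definition _ c :=
  GRing.isLinear.Build R 'rV[R]_3 R *%R (dot3 c) (dot3_linear c).

(** * Coordinates and oriented volumes *)

Lemma I3_ind (P : 'I_3 -> Prop) : P 0 -> P 1 -> P 2 -> forall i, P i.
Proof.
move=> P0 P1 P2 [[|[|[|//]]] ?].
- by have := P0; congr P; apply: val_inj.
- by have := P1; congr P; apply: val_inj.
- by have := P2; congr P; apply: val_inj.
Qed.

Lemma I4_ind (P : 'I_4 -> Prop) : P 0 -> P 1 -> P 2 -> P 3 -> forall i, P i.
Proof.
move=> P0 P1 P2 P3 [[|[|[|[|//]]]] ?].
- by have := P0; congr P; apply: val_inj.
- by have := P1; congr P; apply: val_inj.
- by have := P2; congr P; apply: val_inj.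
- by have := P3; congr P; apply: val_inj.
Qed.

Lemma sum_I4 (V : zmodType) (F : 'I_4 -> V) : \sum_i F i = F 0 + F 1 + F 2 + F 3.
Proof.
rewrite 4!big_ord_recl big_ord0 addr0 !addrA.
by congr (_ + _ + _ + _); congr F; apply: val_inj.
Qed.

Lemma point3E (x y z : R) :
  (point3 x y z 0 0 = x) * (point3 x y z 0 1 = y) * (point3 x y z 0 2 = z).
Proof. by rewrite !mxE. Qed.

Lemma row3_eq (u v : 'rV[R]_3) :
  u 0 0 = v 0 0 -> u 0 1 = v 0 1 -> u 0 2 = v 0 2 -> u = v.
Proof. by move=> *; apply/rowP; apply: I3_ind. Qed.

Definition triple (u v w : 'rV[R]_3) : R :=
  u 0 0 * (v 0 1 * w 0 2 - v 0 2 * w 0 1)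
  - u 0 1 * (v 0 0 * w 0 2 - v 0 2 * w 0 0)
  + u 0 2 * (v 0 0 * w 0 1 - v 0 1 * w 0 0).

(** Six times the signed volume of the tetrahedron.  Written with differences to
    the last vertex, but it is the determinant of the four points in homogeneous
    coordinates, hence affine in each vertex. *)
Definition vol (a : 'I_4 -> 'rV[R]_3) : R :=
  triple (a 0 - a 3) (a 1 - a 3) (a 2 - a 3).

Definition replace_vertex (a : 'I_4 -> 'rV[R]_3) m p :=
  fun i => if i == m then p else a i.

Lemma vol_replaceE a p :
  (vol (replace_vertex a 0 p) = triple (p - a 3) (a 1 - a 3) (a 2 - a 3)) *
  (vol (replace_vertex a 1 p) = triple (a 0 - a 3) (p - a 3) (a 2 - a 3)) *
  (vol (replace_vertex a 2 p) = triple (a 0 - a 3) (a 1 - a 3) (p - a 3)) *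
  (vol (replace_vertex a 3 p) = triple (a 0 - p) (a 1 - p) (a 2 - p)).
Proof. by []. Qed.

Lemma sum_vol_replace a p : \sum_m vol (replace_vertex a m p) = vol a.
Proof. by rewrite sum_I4 !vol_replaceE /vol /triple !mxE; ring. Qed.

(** Cramer's rule: the volumes obtained by replacing one vertex by [p] are,
    up to the factor [vol a], the barycentric coordinates of [p].  This
    turns membership in the tetrahedron into sign conditions that are
    polynomial in the vertices. *)
Lemma vol_replace_comb a p :
  \sum_m vol (replace_vertex a m p) *: a m = vol a *: p.
Proof.
rewrite sum_I4 !vol_replaceE /vol /triple.
by apply: row3_eq; rewrite !mxE; ring.
Qed.

Lemma vol_replace_hull a (w : 'I_4 -> R) m : \sum_i w i = 1 ->
  vol (replace_vertex a m (\sum_i w i *: a i)) = w m * vol a.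
Proof.
rewrite !sum_I4 => w1; have {w1}w1 : w 3 = 1 - (w 0 + w 1 + w 2) by lra.
move: m; apply: I4_ind; rewrite !vol_replaceE /vol /triple !mxE w1; ring.
Qed.

(** * Interior points of a tetrahedron *)

Lemma cvg_coord (T : Type) (F : set_system T) (FF : Filter F) m n
    (f : T -> 'M[R]_(m, n)) (M : 'M[R]_(m, n)) i j :
  f x @[x --> F] --> M -> f x i j @[x --> F] --> M i j.
Proof.
move=> fM.
have cont : {for M, continuous (fun N : 'M[R]_(m, n) => N i j)}.
  exact: coord_continuous.
by have := continuous_cvg FF cont fM.
Qed.

Lemma cvg_triple (T : Type) (F : set_system T) (FF : Filter F)
    (u v w : T -> 'rV[R]_3) (u0 v0 w0 : 'rV[R]_3) :
  u x @[x --> F] --> u0 -> v x @[x --> F] --> v0 -> w x @[x --> F] --> w0 ->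
  triple (u x) (v x) (w x) @[x --> F] --> triple u0 v0 w0.
Proof.
move=> uu vv ww; rewrite /triple.
have M2 i j : v x 0 i * w x 0 j @[x --> F] --> v0 0 i * w0 0 j.
  by apply: cvgM; apply: cvg_coord.
by apply: cvgD; [apply: cvgB|]; apply: cvgM;
  (apply: cvg_coord || apply: cvgB) => //; apply: M2.
Qed.

Lemma cvg_vol (T : Type) (F : set_system T) (FF : Filter F)
    (a : T -> 'I_4 -> 'rV[R]_3) (a0 : 'I_4 -> 'rV[R]_3) :
  (forall i, a x i @[x --> F] --> a0 i) -> vol (a x) @[x --> F] --> vol a0.
Proof. by move=> aa; apply: cvg_triple; apply: cvgB. Qed.

Lemma cvg_dot3 (T : Type) (F : set_system T) (FF : Filter F) c
    (u : T -> 'rV[R]_3) (u0 : 'rV[R]_3) :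
  u x @[x --> F] --> u0 -> dot3 c (u x) @[x --> F] --> dot3 c u0.
Proof.
move=> uu; rewrite /dot3.
by do 2?[apply: cvgD]; (apply: cvgM; [exact: cvg_cst | exact: cvg_coord]).
Qed.

Lemma cvg_replace_vertex (T : Type) (F : set_system T) (FF : Filter F)
    (a : T -> 'I_4 -> 'rV[R]_3) (a0 : 'I_4 -> 'rV[R]_3) m
    (p : T -> 'rV[R]_3) p0 :
  (forall i, a x i @[x --> F] --> a0 i) -> p x @[x --> F] --> p0 ->
  forall i, replace_vertex (a x) m (p x) i @[x --> F] --> replace_vertex a0 m p0 i.
Proof. by move=> aa pp i; rewrite /replace_vertex; case: (i == m). Qed.

Lemma interior_convex_hull a p : 0 < vol a ->
  (forall m, 0 < vol (replace_vertex a m p)) -> (convex_hull a)° p.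
Proof.
move=> a0 pa; rewrite /interior /=.
have : \forall x \near p, forall m, 0 < vol (replace_vertex a m x).
  apply: (@filter_forall _ _ _ _ (nbhs_filter p)) => m.
  apply: (@cvgr_gt _ _ _ _ _ (vol (replace_vertex a m p)) _ _ (pa m)).
  by apply: cvg_vol; apply: cvg_replace_vertex => // i; exact: cvg_cst.
apply: filterS => x xa; exists (fun m => vol (replace_vertex a m x) / vol a).
split => [m||]; first by rewrite divr_ge0 ?ltW.
  by rewrite -mulr_suml sum_vol_replace divff ?gt_eqF.
under eq_bigr do rewrite mulrC -scalerA.
by rewrite -scaler_sumr vol_replace_comb scalerA mulVf ?scale1r ?gt_eqF.
Qed.

Lemma vol_replace_convex_hull_ge0 a p m : 0 < vol a -> convex_hull a p ->
  0 <= vol (replace_vertex a m p).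
Proof. by move=> a0 [w [w0 w1 ->]]; rewrite vol_replace_hull // mulr_ge0 // ltW. Qed.

(** Moving from [p] away from the vertex [a m] decreases the barycentric
    coordinate [m] at a constant rate. *)
Lemma vol_replace_line a m p t :
  vol (replace_vertex a m (p - t *: (a m - p))) =
  (1 + t) * vol (replace_vertex a m p) - t * vol a.
Proof.
by move: m; apply: I4_ind; rewrite !vol_replaceE /vol /triple !mxE; ring.
Qed.

(** At an interior point one can still move a little away from [a m] inside the
    hull, where the coordinate [m] is nonnegative; so it was positive. *)
Lemma vol_replace_interior_gt0 a p m : 0 < vol a -> (convex_hull a)° p ->
  0 < vol (replace_vertex a m p).
Proof.
move=> a0 pa.
have : \forall t \near 0^'+, convex_hull a (p - t *: (a m - p)).
  apply: cvg_at_right_filter pa.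
  rewrite -[X in _ --> X]subr0 -(scale0r (a m - p)).
  by apply: cvgB; [exact: cvg_cst | apply: cvgZr_tmp; exact: cvg_id].
move=> near_p.
have [t [t0 tp]] : exists t : R, 0 < t /\ convex_hull a (p - t *: (a m - p)).
  near (0:R)^'+ => t; exists t; split; near: t => //.
  exact: nbhs_right_gt.
have := vol_replace_convex_hull_ge0 m a0 tp; rewrite vol_replace_line => h.
have : 0 < (1 + t) * vol (replace_vertex a m p).
  by apply: lt_le_trans (mulr_gt0 t0 a0) _; rewrite -subr_ge0.
by rewrite pmulr_rgt0 // addr_gt0.
Unshelve. all: by end_near. Qed.

(** * The tetrahedron is hollow *)

Local Notation s := (Num.sqrt 2 : R).

Lemma sqrt2_sq : s ^+ 2 = 2.
Proof. by rewrite sqr_sqrtr. Qed.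

Lemma sqrt2_gt0 : 0 < s.
Proof. by rewrite sqrtr_gt0. Qed.

Lemma sqrt2_bounds : 7 / 5 < s < 17 / 12.
Proof. by have := sqrt2_sq; have := sqrt2_gt0 => s0 s2; apply/andP; split; nra. Qed.

Lemma vol_replace_DeltaE (x y z : R) :
  let p := point3 x y z in
  (vol (replace_vertex (Delta_vertex R) 0 p) =
     8 * (1 + s) * ((1 + s) * x + y + s * z + 2 * (1 + s))) *
  (vol (replace_vertex (Delta_vertex R) 1 p) =
     8 * (1 + s) * ((1 + s) * y - x - s * z + 2 * (1 + s))) *
  (vol (replace_vertex (Delta_vertex R) 2 p) =
     8 * (1 + s) * (- (1 + s) * x - y + s * z + 2 * (1 + s))) *
  (vol (replace_vertex (Delta_vertex R) 3 p) =
     8 * (1 + s) * (- (1 + s) * y + x - s * z + 2 * (1 + s))).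
Proof.
rewrite /= !vol_replaceE /triple !mxE /=.
have s2 := sqrt2_sq; have s3 : s ^+ 3 = 2 * s by rewrite exprSr s2.
have s2M t : s ^+ 2 * t = 2 * t by rewrite s2.
by do !split; have := s2M x; have := s2M y; have := s2M z; lra.
Qed.

Lemma vol_Delta_gt0 : 0 < vol (Delta_vertex R).
Proof.
rewrite -(sum_vol_replace _ (point3 0 0 0)) sum_I4 !vol_replace_DeltaE.
by have := sqrt2_gt0 => s0; nra.
Qed.

Lemma Delta_vertex_free : affinely_independent (Delta_vertex R).
Proof.
move=> w; rewrite !sum_I4 => w0 wa.
have /(congr1 (fun v : 'rV[R]_3 => v 0 0)) := wa.
have /(congr1 (fun v : 'rV[R]_3 => v 0 1)) := wa.
have /(congr1 (fun v : 'rV[R]_3 => v 0 2)) := wa.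
rewrite !mxE /= => ez ey ex; have s0 := sqrt2_gt0; have s2 := sqrt2_sq.
have s2M t : s ^+ 2 * t = 2 * t by rewrite s2.
have d02 : w 0 - w 2 = 0.
  apply: (mulfI (x := 8 + 4 * s)); first by rewrite gt_eqF //; lra.
  have := congr1 (GRing.mul (2 + s)) ex; have := congr1 (GRing.mul s) ey.
  by have := s2M (w 0); have := s2M (w 2); have := s2M (w 1); have := s2M (w 3); lra.
have d13 : w 1 - w 3 = 0.
  apply: (mulfI (x := 8 + 4 * s)); first by rewrite gt_eqF //; lra.
  have := congr1 (GRing.mul s) ex; have := congr1 (GRing.mul (2 + s)) ey.
  by have := s2M (w 0); have := s2M (w 2); have := s2M (w 1); have := s2M (w 3); lra.
have d0123 : w 0 - w 1 + w 2 - w 3 = 0.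
  apply: (mulfI (x := 2 + s)); first by rewrite gt_eqF //; lra.
  by lra.
by apply: I4_ind; lra.
Qed.

Lemma odd_lt4 (a : int) : (a = 1 %[mod 2])%Z -> (a%:~R : R) < 4 ->
  - 4 < (a%:~R : R) -> [\/ a = - 3, a = - 1, a = 1 | a = 3].
Proof.
rewrite -[4]/(4%:~R) -rmorphN /= !ltr_int => a1 a4 a4'.
have : a = - 3 \/ a = - 1 \/ a = 1 \/ a = 3 by lia.
by case=> [|[|[|]]] ->; [constructor 1|constructor 2|constructor 3|constructor 4].
Qed.

(** Interior points satisfy the four strict facet inequalities.  These bound all
    coordinates strictly by 4 in absolute value, leaving the odd values -3, -1,
    1, 3, and each remaining lattice point violates one of them. *)
Lemma hollow_Delta : hollow (Lambda R) (Delta R).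
Proof.
rewrite /hollow -subset0 => p [[a [b [c [a1 b1 c1 abc ->]]]] pD].
have [s_lb s_ub] := andP sqrt2_bounds; have s2 := sqrt2_sq.
have fac m : 0 < vol (replace_vertex (Delta_vertex R) m
    (point3 a%:~R b%:~R c%:~R)).
  exact: vol_replace_interior_gt0 vol_Delta_gt0 pD.
have {pD}pos t : 0 < 8 * (1 + s) * t -> 0 < t by rewrite pmulr_rgt0 //; lra.
have := fac 0; rewrite vol_replace_DeltaE => /pos f0.
have := fac 1; rewrite vol_replace_DeltaE => /pos f1.
have := fac 2; rewrite vol_replace_DeltaE => /pos f2.
have := fac 3; rewrite vol_replace_DeltaE => /pos f3 {fac pos}.
set x : R := a%:~R in f0 f1 f2 f3; set y : R := b%:~R in f0 f1 f2 f3.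
set z : R := c%:~R in f0 f1 f2 f3.
have zb : z < 4 /\ - 4 < z by split; nra.
have s2M t : s ^+ 2 * t = 2 * t by rewrite s2.
have mulS t : 0 < t -> 0 < (1 + s) * t by move=> t0; rewrite mulr_gt0 //; lra.
(* [x] and [y] are eliminated from each other by combining opposite facets with
   weights [1 + s] and [1]; this leaves the factor [(1 + s) ^ 2 + 1 = 4 + 2 * s]. *)
have xb : x < 4 /\ - 4 < x.
  by have := s2M x; have := s2M y; have := s2M z => ? ? ?;
  have := mulS _ f0; have := mulS _ f2 => ? ?; split;
  [rewrite -(@ltr_pM2l _ (4 + 2 * s)); lra | rewrite -(@ltr_pM2l _ (4 + 2 * s)); lra].
have yb : y < 4 /\ - 4 < y.
  by have := s2M x; have := s2M y; have := s2M z => ? ? ?;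
  have := mulS _ f1; have := mulS _ f3 => ? ?; split;
  [rewrite -(@ltr_pM2l _ (4 + 2 * s)); lra | rewrite -(@ltr_pM2l _ (4 + 2 * s)); lra].
case: xb yb zb => [xb xb'] [yb yb'] [zb zb'].
have {xb xb' a1} := odd_lt4 a1 xb xb'.
have {yb yb' b1} := odd_lt4 b1 yb yb'.
have {zb zb' c1} := odd_lt4 c1 zb zb'.
rewrite /x /y /z in f0 f1 f2 f3 => {x y z}.
by case=> ?; case=> ?; case=> ?; subst a b c; move: abc f0 f1 f2 f3 => //=; lra.
Qed.

(** * The dual lattice and the width of the tetrahedron *)

(** The direction lattice is twice the face-centred cubic lattice, so its dual
    is half the body-centred one: quarters of integer vectors whose entries all
    have the same parity. *)
Definition quarter_form (p q r : int) : 'rV[R]_3 :=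
  point3 (p%:~R / 4) (q%:~R / 4) (r%:~R / 4).

Lemma quarter_formE p q r v : dot3 (quarter_form p q r) v =
  (p%:~R * v 0 0 + q%:~R * v 0 1 + r%:~R * v 0 2) / 4.
Proof. by rewrite /dot3 !point3E; ring. Qed.

Lemma LambdaI (a b c : int) :
  (a = 1 %[mod 2])%Z -> (b = 1 %[mod 2])%Z -> (c = 1 %[mod 2])%Z ->
  (a + b + c = 1 %[mod 4])%Z -> Lambda R (point3 a%:~R b%:~R c%:~R).
Proof. by move=> *; exists a, b, c. Qed.

Lemma dual_LambdaI p q r : (p = q %[mod 2])%Z -> (q = r %[mod 2])%Z ->
  dual_lattice (direction_lattice (Lambda R)) (dot3 (quarter_form p q r)).
Proof.
move=> pq qr _ [_ [_ [[a [b [c [a1 b1 c1 abc ->]]]]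
  [a' [b' [c' [a1' b1' c1' abc' ->]]]] ->]]].
have [k kE] : exists k : int,
    p * (a - a') + q * (b - b') + r * (c - c') = k * 4.
  have half (m n : int) : (m = n %[mod 2])%Z -> exists i, m = n + 2 * i.
    by move=> mn; exists ((m - n) %/ 2)%Z; lia.
  have [i ->] : exists i, p = r + 2 * i by apply: half; lia.
  have [j ->] : exists j, q = r + 2 * j by apply: half; lia.
  have [u uE] : exists u, a = a' + 2 * u by apply: half; lia.
  have [v vE] : exists v, b = b' + 2 * v by apply: half; lia.
  have [t tE] : exists t, a + b + c = a' + b' + c' + 4 * t.
    by exists ((a + b + c - (a' + b' + c')) %/ 4)%Z; lia.
  exists (r * t + i * u + j * v).
  have -> : c = c' + 4 * t - 2 * u - 2 * v by lia.
  by rewrite uE vE; ring.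
apply/intrP; exists k; rewrite /= quarter_formE !mxE.
apply: (mulIf (x := 4)) => //; rewrite mulfVK //.
rewrite -[4]/(4%:~R) -rmorphM /= -kE; ring.
Qed.

Lemma dual_LambdaE f : dual_lattice (direction_lattice (Lambda R)) f ->
  exists p q r, [/\ (p = q %[mod 2])%Z, (q = r %[mod 2])%Z &
    f =1 dot3 (quarter_form p q r)].
Proof.
move=> fL.
have LP a b c a' b' c' :
    (a = 1 %[mod 2])%Z -> (b = 1 %[mod 2])%Z -> (c = 1 %[mod 2])%Z ->
    (a + b + c = 1 %[mod 4])%Z ->
    (a' = 1 %[mod 2])%Z -> (b' = 1 %[mod 2])%Z -> (c' = 1 %[mod 2])%Z ->
    (a' + b' + c' = 1 %[mod 4])%Z ->
    exists k : int, f (point3 (a - a')%:~R (b - b')%:~R (c - c')%:~R) = k%:~R.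
  move=> *; apply/intrP; apply: fL.
  exists (point3 a%:~R b%:~R c%:~R), (point3 a'%:~R b'%:~R c'%:~R).
  split; try exact: LambdaI.
  by apply: row3_eq; rewrite !mxE /= rmorphB.
(* The values at 4 times the basis vectors give the entries; those at (2, 2, 0)
   and (0, 2, 2) give the parities. *)
have [p pE] := LP 5 1 (- 1) 1 1 (- 1) erefl erefl erefl erefl erefl erefl erefl erefl.
have [q qE] := LP 1 5 (- 1) 1 1 (- 1) erefl erefl erefl erefl erefl erefl erefl erefl.
have [r rE] := LP 1 1 3 1 1 (- 1) erefl erefl erefl erefl erefl erefl erefl erefl.
have [k kE] := LP 3 3 (- 1) 1 1 (- 1) erefl erefl erefl erefl erefl erefl erefl erefl.
have [l lE] := LP (-1) 3 3 (- 1) 1 1 erefl erefl erefl erefl erefl erefl erefl erefl.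
have fE v : f v = dot3 (quarter_form p q r) v.
  have -> : v = (v 0 0 / 4) *: point3 (5 - 1)%:~R (1 - 1)%:~R (- 1 - - 1)%:~R
    + (v 0 1 / 4) *: point3 (1 - 1)%:~R (5 - 1)%:~R (- 1 - - 1)%:~R
    + (v 0 2 / 4) *: point3 (1 - 1)%:~R (1 - 1)%:~R (3 - - 1)%:~R.
    by apply: row3_eq; rewrite !mxE /=; field.
  rewrite !linearD !linearZ /= pE qE rE !quarter_formE !mxE /=.
  by field.
exists p, q, r; split => //.
  move: kE; rewrite fE quarter_formE !mxE /= => kE.
  have : p + q = k * 2.
    by apply: (@intr_inj R); rewrite rmorphD rmorphM /= -kE; field.
  by lia.
move: lE; rewrite fE quarter_formE !mxE /= => lE.
have : q + r = l * 2.
  by apply: (@intr_inj R); rewrite rmorphD rmorphM /= -lE; field.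
by lia.
Qed.

End Simplices.

Section Perturbations.
Variable R : realType.

Local Notation s := (Num.sqrt 2 : R).

Lemma quarter_form_neq0 p q r : [|| p != 0, q != 0 | r != 0] ->
  exists x, dot3 (quarter_form R p q r) x != 0.
Proof.
have E v : (dot3 (quarter_form R p q r) v != 0) =
    (p%:~R * v 0 0 + q%:~R * v 0 1 + r%:~R * v 0 2 != 0 :> R).
  by rewrite quarter_formE mulf_eq0 invr_eq0 pnatr_eq0 orbF.
case/or3P => n0;
  [exists (point3 1 0 0)|exists (point3 0 1 0)|exists (point3 0 0 1)];
  by rewrite E !point3E !(mulr0, mulr1, addr0, add0r) intr_eq0.
Qed.

Lemma Delta_vertexE :
  (Delta_vertex R 0 = point3 (2 + s) s (2 + s)) *
  (Delta_vertex R 1 = point3 (- s) (2 + s) (- 2 - s)) *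
  (Delta_vertex R 2 = point3 (- 2 - s) (- s) (2 + s)) *
  (Delta_vertex R 3 = point3 s (- 2 - s) (- 2 - s)).
Proof. by []. Qed.

(** The two diagonals of the quadrilateral of vertices bound [p] and [q], and the
    sum over two opposite sides bounds [r]. *)
Lemma narrow_form_bounds (p q r : int) :
  (forall i j, dot3 (quarter_form R p q r) (Delta_vertex R i)
     - dot3 (quarter_form R p q r) (Delta_vertex R j) < 2 + s) ->
  [/\ - 3 < p < 3, - 3 < q < 3 & - 2 < r < 2].
Proof.
move=> W; have [s_lb s_ub] := andP (sqrt2_bounds R); have s2 := sqrt2_sq R.
have s2M (t : int) : s ^+ 2 * t%:~R = 2 * t%:~R by rewrite s2.
have gap u v : u < v -> 0 < s * (v - u) by move=> uv; rewrite mulr_gt0; lra.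
have lt_int (t n : int) : (8 + 4 * s) * t%:~R < (8 + 4 * s) * n%:~R -> t < n.
  by rewrite ltr_pM2l ?ltr_int //; lra.
have abs_lt (t n : int) : - t < n -> t < n -> - n < t < n.
  by move=> tn nt; rewrite nt ltrNl tn.
split; apply: abs_lt; apply: lt_int; rewrite ?rmorphN /=.
- have := W 2 0; have := gap _ _ (W 2 0); have := gap _ _ (W 1 3).
  have := s2M p; have := s2M q; have := s2M r.
  by rewrite !quarter_formE !Delta_vertexE !point3E; lra.
- have := W 0 2; have := gap _ _ (W 0 2); have := gap _ _ (W 3 1).
  have := s2M p; have := s2M q; have := s2M r.
  by rewrite !quarter_formE !Delta_vertexE !point3E; lra.
- have := W 3 1; have := gap _ _ (W 3 1); have := gap _ _ (W 2 0).
  have := s2M p; have := s2M q; have := s2M r.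
  by rewrite !quarter_formE !Delta_vertexE !point3E; lra.
- have := W 1 3; have := gap _ _ (W 1 3); have := gap _ _ (W 0 2).
  have := s2M p; have := s2M q; have := s2M r.
  by rewrite !quarter_formE !Delta_vertexE !point3E; lra.
- have := W 1 0; have := W 3 2.
  by rewrite !quarter_formE !Delta_vertexE !point3E; lra.
- have := W 0 1; have := W 2 3.
  by rewrite !quarter_formE !Delta_vertexE !point3E; lra.
Qed.

Lemma small_dual_forms (p q r : int) :
  (p = q %[mod 2])%Z -> (q = r %[mod 2])%Z ->
  - 3 < p < 3 -> - 3 < q < 3 -> - 2 < r < 2 ->
  (r = 0 /\ (p = 0 \/ p = - 2 \/ p = 2) /\ (q = 0 \/ q = - 2 \/ q = 2)) \/
  ((r = - 1 \/ r = 1) /\ (p = - 1 \/ p = 1) /\ (q = - 1 \/ q = 1)).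
Proof. lia. Qed.

Lemma lattice_width_Delta : lattice_width (Lambda R) (Delta R) = 2 + s.
Proof.
have [s_lb s_ub] := andP (sqrt2_bounds R).
have Lf : dual_lattice (direction_lattice (Lambda R)) (dot3 (quarter_form R 2 0 0)).
  exact: dual_LambdaI.
have f0 := @quarter_form_neq0 2 0 0 isT.
apply/eqP; rewrite eq_le; apply/andP; split.
  apply: le_trans (lattice_width_le _ Lf f0) _.
  rewrite (@width_convex_hullE R _ _ _ _ 0 2) /=; last first.
    by apply: I4_ind; rewrite !quarter_formE !Delta_vertexE !point3E;
      apply/andP; split; lra.
  by rewrite !quarter_formE !Delta_vertexE !point3E; lra.
apply: lb_le_inf.
  exists (width (Delta R) (dot3 (quarter_form R 2 0 0))).
  by exists (dot3 (quarter_form R 2 0 0)).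
move=> _ [f [fL [x fx]] <-]; rewrite leNgt; apply/negP => fW.
have [p [q [r [pq qr fE]]]] := dual_LambdaE fL.
have W i j : dot3 (quarter_form R p q r) (Delta_vertex R i)
    - dot3 (quarter_form R p q r) (Delta_vertex R j) < 2 + s.
  by rewrite -!fE; exact: le_lt_trans (width_convex_hull_ge _ _ _ _) fW.
have pqr0 : ~ [/\ p = 0, q = 0 & r = 0].
  case=> p0 q0 r0; move/eqP: fx; rewrite fE p0 q0 r0 quarter_formE; apply.
  by rewrite !mul0r !addr0 mul0r.
have [p3 q3 r2] := narrow_form_bounds W.
case: (small_dual_forms pq qr p3 q3 r2) => -[rE [pE qE]].
  have := W 0 2; have := W 2 0; have := W 1 3; have := W 3 1.
  rewrite !quarter_formE !Delta_vertexE !point3E => {W fE} w1 w2 w3 w4.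
  case: pE => [pE|[] pE]; case: qE => [qE|[] qE]; subst p q r;
    first [by case: pqr0 | clear - w1 w2 w3 w4 s_lb s_ub; lra].
have := W 0 1; have := W 1 0; have := W 2 3; have := W 3 2.
have := W 0 3; have := W 3 0; have := W 1 2; have := W 2 1.
rewrite !quarter_formE !Delta_vertexE !point3E.
by clear -pE qE rE s_lb s_ub;
  case: pE => pE; case: qE => qE; case: rE => rE; subst p q r; lra.
Qed.

(** * Nearby tetrahedra and their slacks *)

Definition rot (v : 'rV[R]_3) : 'rV[R]_3 := point3 (- v 0 1) (v 0 0) (- v 0 2).

(** The displacement of vertex [n] is recorded in the frame rotated back to
    vertex 0, so that all later formulas are invariant under a cyclic shift of
    the rows of [b]. *)
Definition vertex (b : 'M[R]_(4, 3)) (n : 'I_4) : 'rV[R]_3 :=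
  iter n rot (point3 (2 + s) s (2 + s) + row n b).

Definition facet_point (n : 'I_4) : 'rV[R]_3 := iter n rot (point3 (-1) (-1) (-1)).

Lemma vertexE b :
  (vertex b 0 = point3 (2 + s + b 0 0) (s + b 0 1) (2 + s + b 0 2)) *
  (vertex b 1 = point3 (- (s + b 1 1)) (2 + s + b 1 0) (- (2 + s + b 1 2))) *
  (vertex b 2 = point3 (- (2 + s + b 2 0)) (- (s + b 2 1)) (2 + s + b 2 2)) *
  (vertex b 3 = point3 (s + b 3 1) (- (2 + s + b 3 0)) (- (2 + s + b 3 2))).
Proof.
by do !split; apply: row3_eq; rewrite /vertex /= /rot !mxE /= ?mxE /= ?mxE /= ?opprK.
Qed.

Lemma vertex0 : vertex 0 = Delta_vertex R.
Proof.
apply: funext; apply: I4_ind; rewrite vertexE; apply: row3_eq; rewrite !mxE /=; ring.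
Qed.

Lemma facet_pointE :
  (facet_point 0 = point3 (-1)%:~R (-1)%:~R (-1)%:~R) *
  (facet_point 1 = point3 1%:~R (-1)%:~R 1%:~R) *
  (facet_point 2 = point3 1%:~R 1%:~R (-1)%:~R) *
  (facet_point 3 = point3 (-1)%:~R 1%:~R 1%:~R).
Proof.
by do !split; apply: row3_eq; rewrite /facet_point /= /rot !mxE /= ?mxE /= ?mxE /= ?opprK.
Qed.

Lemma facet_point_Lambda n : Lambda R (facet_point n).
Proof. by move: n; apply: I4_ind; rewrite facet_pointE; apply: LambdaI. Qed.

Lemma cvg_point3 (T : Type) (F : set_system T) (FF : Filter F)
    (x y z : T -> R) (x0 y0 z0 : R) :
  x t @[t --> F] --> x0 -> y t @[t --> F] --> y0 -> z t @[t --> F] --> z0 ->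
  point3 (x t) (y t) (z t) @[t --> F] --> point3 x0 y0 z0.
Proof.
move=> cx cy cz.
have E u v w : point3 u v w =
    u *: point3 1 0 0 + v *: point3 0 1 0 + w *: point3 0 0 1 :> 'rV[R]_3.
  by apply: row3_eq; rewrite !mxE /=; ring.
under eq_fun do rewrite E; rewrite E.
by do 2?[apply: cvgD]; apply: cvgZ => //; exact: cvg_cst.
Qed.

Lemma cvg_vertex (T : Type) (F : set_system T) (FF : Filter F)
    (f : T -> 'M[R]_(4, 3)) (M : 'M[R]_(4, 3)) n :
  f t @[t --> F] --> M -> vertex (f t) n @[t --> F] --> vertex M n.
Proof.
move=> fM; have cc i j := cvg_coord FF (i := i) (j := j) fM.
by move: n; apply: I4_ind; under eq_fun do rewrite vertexE; rewrite vertexE;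
  apply: cvg_point3; do ?apply: cvgN; apply: cvgD => //; exact: cvg_cst.
Qed.

Lemma cvg_vertex0 n : vertex b n @[b --> (0 : 'M[R]_(4, 3))] --> Delta_vertex R n.
Proof.
rewrite -vertex0; have := @cvg_vertex _ _ (nbhs_filter (0 : 'M[R]_(4, 3))) id 0 n.
by apply; exact: cvg_id.
Qed.

(** A functional whose maximum and minimum over the vertices are attained at
    single vertices [i] and [j] keeps them there under small perturbations, so
    its width remains a difference of two vertex values. *)
Lemma near_width_constraint (T : Type) (F : set_system T) (FF : Filter F)
    (v : T -> 'I_4 -> 'rV[R]_3) p q r i j : let f := dot3 (quarter_form R p q r) in
  (forall n, v b n @[b --> F] --> Delta_vertex R n) ->
  (p = q %[mod 2])%Z -> (q = r %[mod 2])%Z -> [|| p != 0, q != 0 | r != 0] ->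
  (forall k, k != i -> f (Delta_vertex R k) < f (Delta_vertex R i)) ->
  (forall k, k != j -> f (Delta_vertex R j) < f (Delta_vertex R k)) ->
  \forall b \near F,
    2 + s <= lattice_width (Lambda R) (convex_hull (v b)) ->
    2 + s <= f (v b i) - f (v b j).
Proof.
move=> f vD pq qr pqr0 fi fj.
have lt_near k l : f (Delta_vertex R k) < f (Delta_vertex R l) ->
    \forall b \near F, f (v b k) <= f (v b l).
  move=> kl; have : 0 < f (Delta_vertex R l) - f (Delta_vertex R k) by rewrite subr_gt0.
  have cf : f (v b l) - f (v b k) @[b --> F] -->
      f (Delta_vertex R l) - f (Delta_vertex R k).
    by apply: cvgB; apply: cvg_dot3; exact: vD.
  move=> /(cvgr_gt _ cf); apply: filterS => b; rewrite subr_gt0; exact: ltW.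
have nij : \forall b \near F,
    forall k, f (v b j) <= f (v b k) <= f (v b i).
  apply: filter_forall => k.
  have ni : \forall b \near F, f (v b k) <= f (v b i).
    have [->|ki] := eqVneq k i; first by apply: nearW.
    exact: lt_near (fi _ ki).
  have nj : \forall b \near F, f (v b j) <= f (v b k).
    have [->|kj] := eqVneq k j; first by apply: nearW.
    exact: lt_near (fj _ kj).
  by near=> b; apply/andP; split; near: b.
apply: filterS nij => b bij /le_trans; apply.
rewrite -(@width_convex_hullE R _ _ _ f i j) //.
apply: lattice_width_le; first exact: dual_LambdaI.
exact: quarter_form_neq0.
Unshelve. all: by end_near. Qed.

(** The strict conditions for the other facets persist, so if the volume for [m]
    were positive too then [p] would be a lattice point in the interior. *)
Lemma near_facet_constraint (T : Type) (F : set_system T) (FF : Filter F)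
    (v : T -> 'I_4 -> 'rV[R]_3) m p :
  (forall n, v b n @[b --> F] --> Delta_vertex R n) -> Lambda R p ->
  (forall k, k != m -> 0 < vol (replace_vertex (Delta_vertex R) k p)) ->
  \forall b \near F,
    hollow (Lambda R) (convex_hull (v b)) ->
    vol (replace_vertex (v b) m p) <= 0.
Proof.
move=> vD Lp pos.
have cv k : vol (replace_vertex (v b) k p) @[b --> F] -->
    vol (replace_vertex (Delta_vertex R) k p).
  apply: cvg_vol; apply: cvg_replace_vertex; last exact: cvg_cst.
  exact: vD.
have nk : \forall b \near F, forall k, k != m ->
    0 < vol (replace_vertex (v b) k p).
  apply: filter_forall => k.
  have [->|km] := eqVneq k m; first by apply: nearW.
  by apply: filterS (cvgr_gt _ (cv k) _ (pos k km)) => b ? _.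
have nv : \forall b \near F, 0 < vol (v b).
  exact: cvgr_gt (cvg_vol FF vD) _ (vol_Delta_gt0 R).
near=> b; move=> hb; rewrite leNgt; apply/negP => pm.
suff : (Lambda R `&` (convex_hull (v b))°) p by rewrite hb.
split=> //; apply: interior_convex_hull => [|k]; first by near: b.
have [->//|km] := eqVneq k m.
by move: k km; near: b.
Unshelve. all: by end_near. Qed.

Lemma addI4E :
  ((0 : 'I_4) + 1 = 1) * ((1 : 'I_4) + 1 = 2) * ((2 : 'I_4) + 1 = 3) *
  ((3 : 'I_4) + 1 = 0) * ((0 : 'I_4) + 2 = 2) * ((1 : 'I_4) + 2 = 3) *
  ((2 : 'I_4) + 2 = 0) * ((3 : 'I_4) + 2 = 1) * ((0 : 'I_4) + 3 = 3) *
  ((1 : 'I_4) + 3 = 0) * ((2 : 'I_4) + 3 = 1) * ((3 : 'I_4) + 3 = 2) *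
  ((0 : 'I_4) - 1 = 3) * ((1 : 'I_4) - 1 = 0) * ((2 : 'I_4) - 1 = 1) *
  ((3 : 'I_4) - 1 = 2).
Proof. by do !split; apply: val_inj. Qed.

(** Twice the excess over [2 + sqrt 2] of the difference of [x / 2] (for even [n])
    or [y / 2] (for odd [n]) between the vertices [n] and [n + 2]. *)
Definition diagonal_slack (b : 'M[R]_(4, 3)) (n : 'I_4) : R := b n 0 + b (n + 2) 0.

(** Four times the excess over [2 + sqrt 2] of the difference of the functional
    [rot ^ n (1, 1, 1) / 4] between the vertices [n] and [n - 1]. *)
Definition side_slack (b : 'M[R]_(4, 3)) (n : 'I_4) : R :=
  b n 0 + b n 1 + b n 2 + (b (n - 1) 0 - b (n - 1) 1 + b (n - 1) 2).

Definition facet_slack (b : 'M[R]_(4, 3)) (n : 'I_4) : R :=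
  - vol (replace_vertex (vertex b) n (facet_point n)).

Lemma near_slacks_ge0 : \forall b \near (0 : 'M[R]_(4, 3)),
  hollow (Lambda R) (convex_hull (vertex b)) ->
  2 + s <= lattice_width (Lambda R) (convex_hull (vertex b)) ->
  forall n, [/\ 0 <= diagonal_slack b n, 0 <= side_slack b n & 0 <= facet_slack b n].
Proof.
have [s_lb s_ub] := andP (sqrt2_bounds R).
have diag : \forall b \near (0 : 'M[R]_(4, 3)),
    2 + s <= lattice_width (Lambda R) (convex_hull (vertex b)) ->
    forall n, 0 <= diagonal_slack b n.
  have W p q r i j := @near_width_constraint _ _ (nbhs_filter (0 : 'M[R]_(4, 3)))
    _ p q r i j cvg_vertex0.
  have W0 := W 2 0 0 0 2 erefl erefl isT.
  have W1 := W 0 2 0 1 3 erefl erefl isT.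
  have {}W0 := W0 ltac:(by apply: I4_ind => //; rewrite !quarter_formE !mxE /=; lra)
                  ltac:(by apply: I4_ind => //; rewrite !quarter_formE !mxE /=; lra).
  have {}W1 := W1 ltac:(by apply: I4_ind => //; rewrite !quarter_formE !mxE /=; lra)
                  ltac:(by apply: I4_ind => //; rewrite !quarter_formE !mxE /=; lra).
  apply: filterS2 W0 W1 => b /[swap] W1 /[swap] bW /(_ bW) W0.
  move: (W1 bW) W0; rewrite !quarter_formE !vertexE !point3E => W1' W0.
  by apply: I4_ind; rewrite /diagonal_slack !addI4E; lra.
have side n : \forall b \near (0 : 'M[R]_(4, 3)),
    2 + s <= lattice_width (Lambda R) (convex_hull (vertex b)) ->
    0 <= side_slack b n.
  have W p q r i j := @near_width_constraint _ _ (nbhs_filter (0 : 'M[R]_(4, 3)))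
    _ p q r i j cvg_vertex0.
  move: n; apply: I4_ind.
  - have N := W 1 1 1 0 3 erefl erefl isT
      ltac:(by apply: I4_ind => //; rewrite !quarter_formE !mxE /=; lra)
      ltac:(by apply: I4_ind => //; rewrite !quarter_formE !mxE /=; lra).
    apply: filterS N => b /[apply].
    by rewrite !quarter_formE !vertexE !point3E /side_slack !addI4E; lra.
  - have N := W (-1) 1 (-1) 1 0 erefl erefl isT
      ltac:(by apply: I4_ind => //; rewrite !quarter_formE !mxE /=; lra)
      ltac:(by apply: I4_ind => //; rewrite !quarter_formE !mxE /=; lra).
    apply: filterS N => b /[apply].
    by rewrite !quarter_formE !vertexE !point3E /side_slack !addI4E; lra.
  - have N := W (-1) (-1) 1 2 1 erefl erefl isT
      ltac:(by apply: I4_ind => //; rewrite !quarter_formE !mxE /=; lra)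
      ltac:(by apply: I4_ind => //; rewrite !quarter_formE !mxE /=; lra).
    apply: filterS N => b /[apply].
    by rewrite !quarter_formE !vertexE !point3E /side_slack !addI4E; lra.
  - have N := W 1 (-1) (-1) 3 2 erefl erefl isT
      ltac:(by apply: I4_ind => //; rewrite !quarter_formE !mxE /=; lra)
      ltac:(by apply: I4_ind => //; rewrite !quarter_formE !mxE /=; lra).
    apply: filterS N => b /[apply].
    by rewrite !quarter_formE !vertexE !point3E /side_slack !addI4E; lra.
have facet n : \forall b \near (0 : 'M[R]_(4, 3)),
    hollow (Lambda R) (convex_hull (vertex b)) -> 0 <= facet_slack b n.
  have pos k : k != n -> 0 < vol (replace_vertex (Delta_vertex R) k (facet_point n)).
    have s1 : 0 < 8 * (1 + s) by lra.
    by move: k; apply: I4_ind; move: n; apply: I4_ind => //= _;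
      rewrite facet_pointE vol_replace_DeltaE pmulr_rgt0 //=; lra.
  have N := near_facet_constraint (nbhs_filter (0 : 'M[R]_(4, 3))) cvg_vertex0
    (facet_point_Lambda n) pos.
  by apply: filterS N => b /[apply]; rewrite /facet_slack oppr_ge0.
have sides : \forall b \near (0 : 'M[R]_(4, 3)),
    forall n, 2 + s <= lattice_width (Lambda R) (convex_hull (vertex b)) ->
    0 <= side_slack b n.
  by apply: (@filter_forall _ _ _ _ (nbhs_filter (0 : 'M[R]_(4, 3)))) => n; exact: side.
have facets : \forall b \near (0 : 'M[R]_(4, 3)),
    forall n, hollow (Lambda R) (convex_hull (vertex b)) -> 0 <= facet_slack b n.
  by apply: (@filter_forall _ _ _ _ (nbhs_filter (0 : 'M[R]_(4, 3)))) => n; exact: facet.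
near=> b => bH bW n; split.
- by move: bW n; near: b.
- by move: n bW; near: b.
- by move: n bH; near: b.
Unshelve. all: by end_near. Qed.

(** * Domination near a point *)

Section Dominated.
Variables (T : Type) (F : set_system T) (FF : Filter F).
Implicit Types f g : T -> R.

(** [f = O(g)] along [F], with the constant applied to [g] itself because the
    comparison functions below are sums and products of nonnegative sizes. *)
Definition dominated f g :=
  exists2 K : R, 0 <= K & \forall t \near F, `|f t| <= K * g t.

Lemma dominated_eq f1 f2 g : f1 =1 f2 -> dominated f1 g -> dominated f2 g.
Proof. by move=> /funext ->. Qed.

Lemma dominatedD f1 f2 g :
  dominated f1 g -> dominated f2 g -> dominated (fun t => f1 t + f2 t) g.
Proof.
move=> [K1 K10 f1g] [K2 K20 f2g]; exists (K1 + K2); first exact: addr_ge0.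
apply: filterS2 f1g f2g => t f1t f2t.
by rewrite mulrDl (le_trans (ler_normD _ _)) // lerD.
Qed.

Lemma dominatedM f1 f2 g1 g2 : dominated f1 g1 -> dominated f2 g2 ->
  dominated (fun t => f1 t * f2 t) (fun t => g1 t * g2 t).
Proof.
move=> [K1 K10 f1g] [K2 K20 f2g]; exists (K1 * K2); first exact: mulr_ge0.
apply: filterS2 f1g f2g => t f1t f2t.
by rewrite normrM mulrACA ler_pM.
Qed.

Lemma dominatedZ c f g : dominated f g -> dominated (fun t => c * f t) g.
Proof.
move=> [K K0 fg]; exists (`|c| * K); first exact: mulr_ge0.
by apply: filterS fg => t ft; rewrite normrM -mulrA ler_wpM2l.
Qed.

Lemma dominatedN f g : dominated f g -> dominated (fun t => - f t) g.
Proof.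
by move=> /(dominatedZ (-1)); apply: dominated_eq => t; rewrite mulN1r.
Qed.

Lemma dominatedB f1 f2 g :
  dominated f1 g -> dominated f2 g -> dominated (fun t => f1 t - f2 t) g.
Proof. by move=> f1g /dominatedN; exact: dominatedD. Qed.

Lemma dominatedZK c f g : c != 0 -> dominated (fun t => c * f t) g -> dominated f g.
Proof.
by move=> c0 /(dominatedZ c^-1); apply: dominated_eq => t; rewrite mulKf.
Qed.

Lemma dominated_cst c : dominated (fun=> c) (fun=> 1).
Proof. by exists `|c| => //; apply: nearW => t; rewrite mulr1. Qed.

Lemma dominated_refl f : dominated f (fun t => `|f t|).
Proof. by exists 1 => //; apply: nearW => t; rewrite mul1r. Qed.

Lemma dominated_norm f g : dominated f g -> dominated (fun t => `|f t|) g.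
Proof. by case=> K K0 fg; exists K => //; apply: filterS fg => t; rewrite normr_id. Qed.

Lemma dominated_ler f g1 g2 : (\forall t \near F, g1 t <= g2 t) ->
  dominated f g1 -> dominated f g2.
Proof.
move=> g12 [K K0 fg]; exists K => //; apply: filterS2 g12 fg => t gt ft.
by apply: le_trans ft _; rewrite ler_wpM2l.
Qed.

Lemma dominated_sum (I : Type) (s : seq I) (f : I -> T -> R) g :
  (forall i, dominated (f i) g) -> dominated (fun t => \sum_(i <- s) f i t) g.
Proof.
move=> fg; elim: s => [|i s IHs].
  by exists 0 => //; apply: nearW => t; rewrite big_nil normr0 mul0r.
apply: (dominated_eq (f1 := fun t => f i t + \sum_(j <- s) f j t)).
  by move=> t; rewrite big_cons.
exact: dominatedD.
Qed.

Definition vdominated m n (v : T -> 'M[R]_(m, n)) g :=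
  forall i j, dominated (fun t => v t i j) g.

Lemma dominated_triple (u v w : T -> 'rV[R]_3) gu gv gw :
  vdominated u gu -> vdominated v gv -> vdominated w gw ->
  dominated (fun t => triple (u t) (v t) (w t)) (fun t => gu t * (gv t * gw t)).
Proof.
move=> ud vd wd; rewrite /triple.
by apply: dominatedD; [apply: dominatedB|]; apply: dominatedM => //;
  apply: dominatedB; apply: dominatedM.
Qed.

Lemma vdominatedB m n (u v : T -> 'M[R]_(m, n)) g :
  vdominated u g -> vdominated v g -> vdominated (fun t => u t - v t) g.
Proof.
move=> ug vg i j; apply: (dominated_eq (f1 := fun t => u t i j - v t i j)).
  by move=> t; rewrite !mxE.
exact: dominatedB.
Qed.

Lemma vdominated_cst m n (v : 'M[R]_(m, n)) : vdominated (fun=> v) (fun=> 1).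
Proof. by move=> i j; exact: dominated_cst. Qed.

(** The part of [vol (e + d)] that is linear in [d]. *)
Definition vol_linear (e d : 'I_4 -> 'rV[R]_3) : R :=
  triple (d 0 - d 3) (e 1 - e 3) (e 2 - e 3) +
  triple (e 0 - e 3) (d 1 - d 3) (e 2 - e 3) +
  triple (e 0 - e 3) (e 1 - e 3) (d 2 - d 3).

(** By multilinearity the remainder is a sum of triple products with at least two
    displaced factors. *)
Lemma vol_taylor (e : 'I_4 -> 'rV[R]_3) (d : T -> 'I_4 -> 'rV[R]_3) r :
  (\forall t \near F, 0 <= r t <= 1) ->
  (forall i, vdominated (fun t => d t i) r) ->
  dominated (fun t => vol (fun i => e i + d t i) - vol e - vol_linear e (d t))
    (fun t => r t ^+ 2).
Proof.
move=> r01 dr.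
have ec i j : vdominated (fun t => e i - e j) (fun=> 1) by exact: vdominated_cst.
have dc i j : vdominated (fun t => d t i - d t j) r by exact: vdominatedB.
have := dominated_triple (dc 0 3) (dc 1 3) (dc 2 3) => t3.
have := dominated_triple (dc 0 3) (dc 1 3) (ec 2 3) => t21.
have := dominated_triple (dc 0 3) (ec 1 3) (dc 2 3) => t22.
have := dominated_triple (ec 0 3) (dc 1 3) (dc 2 3) => t23.
apply: (dominated_eq (f1 := fun t =>
   triple (d t 0 - d t 3) (d t 1 - d t 3) (d t 2 - d t 3) +
   triple (d t 0 - d t 3) (d t 1 - d t 3) (e 2 - e 3) +
   triple (d t 0 - d t 3) (e 1 - e 3) (d t 2 - d t 3) +
   triple (e 0 - e 3) (d t 1 - d t 3) (d t 2 - d t 3))).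
  by move=> t; rewrite /vol /vol_linear /triple !mxE; ring.
apply: dominatedD; last by apply: dominated_ler t23; apply: nearW => t; rewrite mul1r.
apply: dominatedD; last by apply: dominated_ler t22; apply: nearW => t; rewrite mul1r.
apply: dominatedD; last by apply: dominated_ler t21; apply: nearW => t; rewrite mulr1.
apply: dominated_ler t3; apply: filterS r01 => t /andP[r0 r1].
by rewrite -expr2 ler_piMl // sqr_ge0.
Qed.

End Dominated.

End Perturbations.

Section Rigidity.
Variable R : realType.

Local Notation s := (Num.sqrt 2 : R).

(** * Expansion of the slacks *)

Definition displacement (b : 'M[R]_(4, 3)) (n : 'I_4) : 'rV[R]_3 :=
  iter n (@rot R) (row n b).

Lemma displacementE b :
  (displacement b 0 = point3 (b 0 0) (b 0 1) (b 0 2)) *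
  (displacement b 1 = point3 (- b 1 1) (b 1 0) (- b 1 2)) *
  (displacement b 2 = point3 (- b 2 0) (- b 2 1) (b 2 2)) *
  (displacement b 3 = point3 (b 3 1) (- b 3 0) (- b 3 2)).
Proof.
by do !split; apply: row3_eq; rewrite /displacement /= /rot !mxE /= ?mxE /= ?mxE /= ?opprK.
Qed.

Lemma vertexD b n : vertex b n = Delta_vertex R n + displacement b n.
Proof.
move: n; apply: I4_ind; rewrite -vertex0 !vertexE displacementE;
  by apply: row3_eq; rewrite !mxE /=; ring.
Qed.

Lemma replace_vertexD b n p i : replace_vertex (vertex b) n p i =
  replace_vertex (Delta_vertex R) n p i + replace_vertex (displacement b) n 0 i.
Proof. by rewrite /replace_vertex; case: (i == n); rewrite ?addr0 ?vertexD. Qed.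

(** The gradient at [b = 0] of [facet_slack b n]; by the cyclic symmetry the
    coefficients depend only on the row index relative to [n]. *)
Definition facet_linear (b : 'M[R]_(4, 3)) (n : 'I_4) : R :=
  (2 + 2 * s) * b (n + 1) 0 - (6 + 4 * s) * b (n + 1) 1 - (4 + 2 * s) * b (n + 1) 2
  - (8 + 6 * s) * b (n + 2) 0 - (4 + 2 * s) * b (n + 2) 1 + (4 + 4 * s) * b (n + 2) 2
  - (2 + 4 * s) * b (n + 3) 0 + (10 + 6 * s) * b (n + 3) 1 - (8 + 2 * s) * b (n + 3) 2.

Lemma replace_vertex_nth (a : 'I_4 -> 'rV[R]_3) (m i : 'I_4) p :
  replace_vertex a m p i = if i == m then p else a i.
Proof. by []. Qed.

Lemma point3B (x y z x' y' z' : R) :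
  point3 x y z - point3 x' y' z' = point3 (x - x') (y - y') (z - z').
Proof. by apply: row3_eq; rewrite !mxE. Qed.

Lemma triple_point3 (x y z x' y' z' x'' y'' z'' : R) :
  triple (point3 x y z) (point3 x' y' z') (point3 x'' y'' z'') =
  x * (y' * z'' - z' * y'') - y * (x' * z'' - z' * x'') + z * (x' * y'' - y' * x'').
Proof. by rewrite /triple !point3E. Qed.

Lemma point3_0 : 0 = point3 0 0 0 :> 'rV[R]_3.
Proof. by apply: row3_eq; rewrite !mxE. Qed.

Lemma facet_linearE b n :
  vol_linear (replace_vertex (Delta_vertex R) n (facet_point R n))
    (replace_vertex (displacement b) n 0) = - facet_linear b n.
Proof.
apply/eqP; rewrite -subr_eq0 opprK.
(* The two sides differ by a multiple of [s ^ 2 - 2]. *)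
have -> : vol_linear (replace_vertex (Delta_vertex R) n (facet_point R n))
    (replace_vertex (displacement b) n 0) + facet_linear b n =
  2 * (s ^+ 2 - 2) * (b (n + 1) 1 + b (n + 1) 2 + b (n + 2) 0 + b (n + 2) 1
     + b (n + 3) 0 + b (n + 3) 2).
  move: n; apply: I4_ind; rewrite facet_pointE /facet_linear !addI4E;
    rewrite /vol_linear !replace_vertex_nth /= !Delta_vertexE !displacementE;
    by rewrite point3_0 !point3B !triple_point3; ring.
by rewrite (sqrt2_sq R) subrr mulr0 mul0r.
Qed.

Lemma vol_facet_point n :
  vol (replace_vertex (Delta_vertex R) n (facet_point R n)) = 0.
Proof.
have s2 := sqrt2_sq R.
by move: n; apply: I4_ind; rewrite facet_pointE vol_replace_DeltaE;
   apply/eqP; rewrite mulf_eq0; apply/orP; right; apply/eqP; lra.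
Qed.

(** Discrete Fourier coordinates of column [k] for the cyclic shift of the rows:
    eigenvalues 1 and -1, then the plane of the eigenvalues i and -i. *)
Definition mode_one (b : 'M[R]_(4, 3)) k : R := b 0 k + b 1 k + b 2 k + b 3 k.
Definition mode_minus (b : 'M[R]_(4, 3)) k : R := b 0 k - b 1 k + b 2 k - b 3 k.
Definition mode_even (b : 'M[R]_(4, 3)) k : R := b 0 k - b 2 k.
Definition mode_odd (b : 'M[R]_(4, 3)) k : R := b 1 k - b 3 k.

(** The weights on the left are chosen to make the linear parts cancel; this
    is the positive relation between the gradients.  On the right, each product
    in the second group has a first factor that is a combination of diagonal and
    side slacks, and the cubic part [vol (displacement b)] is what
    [sum_vol_replace] leaves of the four facet volumes. *)
Lemma slack_identity b :
  \sum_n (4 * s * diagonal_slack b n + 4 * side_slack b n + facet_slack b n) =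
  - ((1 + s) / 2 * mode_one b 1 ^+ 2
     + (1 + s) * (mode_even b 2 ^+ 2 + mode_odd b 2 ^+ 2))
  + (mode_one b 0 * (- ((1 + s) / 2) * mode_one b 0 - (1 + s) * mode_one b 2)
     + mode_one b 2 * ((1 - s) * mode_one b 1)
     + mode_minus b 0 * ((1 + s) / 2 * mode_minus b 0)
     + mode_minus b 1 * ((1 + s) / 2 * mode_minus b 1)
     + (mode_even b 0 + mode_odd b 1 + mode_even b 2)
         * ((1 + s) * mode_even b 2 + (s - 1) * mode_odd b 2)
     + (mode_odd b 0 - mode_even b 1 + mode_odd b 2)
         * ((1 - s) * mode_even b 2 + (1 + s) * mode_odd b 2))
  - vol (displacement b).
Proof.
have s2 (c L M : R) : L = M + (s ^+ 2 - 2) * c -> L = M.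
  by rewrite (sqrt2_sq R) subrr mul0r addr0.
(* The multiplier is the quotient by [s ^ 2 - 2] of the difference of the sides. *)
apply: (s2 (- 16 - 16 * s - 4 * (mode_one b 0 + mode_one b 1 + mode_one b 2))).
rewrite sum_I4 /diagonal_slack /side_slack /facet_slack /vol !replace_vertex_nth /=.
rewrite !facet_pointE !vertexE !displacementE !addI4E !point3B !triple_point3.
rewrite /mode_one /mode_minus /mode_even /mode_odd.
by field.
Qed.

Lemma le_mx_entry m n (M : 'M[R]_(m, n)) i j : `|M i j| <= `|M|.
Proof.
by rewrite [leRHS]/Num.Def.normr /= mx_normrE; apply/bigmax_geP; right; exists (i, j).
Qed.

Lemma mx_norm_le_sum m n (M : 'M[R]_(m, n)) : `|M| <= \sum_i \sum_j `|M i j|.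
Proof.
rewrite [leLHS]/Num.Def.normr /= mx_normrE; apply: bigmax_le => [|[i j] _ /=].
  by apply: sumr_ge0 => i _; apply: sumr_ge0.
rewrite (bigD1 i) //= (bigD1 j) //= -addrA lerDl addr_ge0 //.
  by apply: sumr_ge0.
by apply: sumr_ge0 => k _; apply: sumr_ge0.
Qed.

(** Absolute values make this a size for every [b]; on the tetrahedra of
    interest, where all slacks are nonnegative, it is just their sum. *)
Definition slack_size (b : 'M[R]_(4, 3)) : R :=
  \sum_n (`|diagonal_slack b n| + `|side_slack b n| + `|facet_slack b n|).

Section Remainders.
Variables (T : Type) (F : set_system T) (FF : Filter F) (b : T -> 'M[R]_(4, 3)).
Hypothesis b1 : \forall t \near F, `|b t| <= 1.

Lemma dominated_entry i j : dominated F (fun t => b t i j) (fun t => `|b t|).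
Proof. by exists 1 => //; apply: nearW => t; rewrite mul1r le_mx_entry. Qed.

Lemma dominated_mode_one k : dominated F (fun t => mode_one (b t) k) (fun t => `|b t|).
Proof. by do 3?[apply: dominatedD => //]; exact: dominated_entry. Qed.

Lemma dominated_mode_minus k : dominated F (fun t => mode_minus (b t) k) (fun t => `|b t|).
Proof.
apply: dominatedB; last exact: dominated_entry.
apply: dominatedD; last exact: dominated_entry.
by apply: dominatedB; exact: dominated_entry.
Qed.

Lemma dominated_mode_even k : dominated F (fun t => mode_even (b t) k) (fun t => `|b t|).
Proof. by apply: dominatedB; exact: dominated_entry. Qed.

Lemma dominated_mode_odd k : dominated F (fun t => mode_odd (b t) k) (fun t => `|b t|).
Proof. by apply: dominatedB; exact: dominated_entry. Qed.

Lemma vdominated_displacement n :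
  vdominated F (fun t => displacement (b t) n) (fun t => `|b t|).
Proof.
move=> i j; rewrite ord1; move: n j; apply: I4_ind; apply: I3_ind;
  under eq_fun do rewrite displacementE point3E; do ?apply: dominatedN;
  exact: dominated_entry.
Qed.

Lemma dominated_slack n :
  [/\ dominated F (fun t => diagonal_slack (b t) n) (fun t => slack_size (b t)),
      dominated F (fun t => side_slack (b t) n) (fun t => slack_size (b t)) &
      dominated F (fun t => facet_slack (b t) n) (fun t => slack_size (b t))].
Proof.
have S0 t : 0 <= \sum_(i | i != n) (`|diagonal_slack (b t) i| + `|side_slack (b t) i|
   + `|facet_slack (b t) i|) by apply: sumr_ge0 => i _; rewrite !addr_ge0.
by split; exists 1 => //; apply: nearW => t; rewrite mul1r /slack_size (bigD1 n) //=;
  have := S0 t; have := normr_ge0 (diagonal_slack (b t) n);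
  have := normr_ge0 (side_slack (b t) n); have := normr_ge0 (facet_slack (b t) n); lra.
Qed.

Lemma dominated_facet_taylor n :
  dominated F (fun t => facet_slack (b t) n - facet_linear (b t) n) (fun t => `|b t| ^+ 2).
Proof.
have dr i : vdominated F (fun t => replace_vertex (displacement (b t)) n 0 i)
    (fun t => `|b t|).
  rewrite /replace_vertex; case: (i == n); last exact: vdominated_displacement.
  by move=> j k; exists 0 => //; apply: nearW => t; rewrite mxE normr0 mul0r.
have r01 : \forall t \near F, 0 <= `|b t| <= 1.
  by apply: filterS b1 => t ->; rewrite normr_ge0.
have := vol_taylor FF (replace_vertex (Delta_vertex R) n (facet_point R n)) r01 dr.
move=> /dominatedN; apply: dominated_eq => t.
rewrite vol_facet_point facet_linearE subr0 opprK opprD /facet_slack; congr (- _ - _).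
by congr vol; apply: funext => i; rewrite replace_vertexD.
Qed.

Let S := fun t => slack_size (b t).

(** These are the first factors occurring in [slack_identity]: exact linear
    combinations of diagonal and side slacks. *)
Lemma linear_modes_slack :
  [/\ dominated F (fun t => mode_one (b t) 0) S,
      dominated F (fun t => mode_minus (b t) 0) S,
      dominated F (fun t => mode_one (b t) 2) S &
      dominated F (fun t => mode_minus (b t) 1) S] /\
  (dominated F (fun t => mode_even (b t) 0 + mode_odd (b t) 1 + mode_even (b t) 2) S /\
   dominated F (fun t => mode_odd (b t) 0 - mode_even (b t) 1 + mode_odd (b t) 2) S).
Proof.
have d n : dominated F (fun t => diagonal_slack (b t) n) S by have [] := dominated_slack n.
have e n : dominated F (fun t => side_slack (b t) n) S by have [] := dominated_slack n.
have x0 : dominated F (fun t => mode_one (b t) 0) S.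
  apply: dominated_eq (dominatedD FF (d 0) (d 1)) => t.
  by rewrite /diagonal_slack !addI4E /mode_one; ring.
have e02 := dominatedD FF (e 0) (e 2); have e13 := dominatedD FF (e 1) (e 3).
have f02 := dominatedB FF (e 0) (e 2); have f13 := dominatedB FF (e 1) (e 3).
split; split => //.
- apply: dominated_eq (dominatedB FF (d 0) (d 1)) => t.
  by rewrite /diagonal_slack !addI4E /mode_minus; ring.
- apply: dominated_eq (dominatedB FF (dominatedZ FF 2^-1 (dominatedD FF e02 e13)) x0) => t.
  by rewrite /side_slack !addI4E /mode_one; field.
- apply: dominated_eq (dominatedZ FF 2^-1 (dominatedB FF e02 e13)) => t.
  by rewrite /side_slack !addI4E /mode_minus; field.
- apply: dominated_eq (dominatedZ FF 2^-1 (dominatedD FF f02 f13)) => t.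
  by rewrite /side_slack !addI4E /mode_even /mode_odd; field.
- apply: dominated_eq (dominatedZ FF 2^-1 (dominatedB FF f13 f02)) => t.
  by rewrite /side_slack !addI4E /mode_even /mode_odd; field.
Qed.

Lemma weighted_slack_expansion :
  dominated F (fun t =>
    \sum_n (4 * s * diagonal_slack (b t) n + 4 * side_slack (b t) n + facet_slack (b t) n)
    + ((1 + s) / 2 * mode_one (b t) 1 ^+ 2
     + (1 + s) * (mode_even (b t) 2 ^+ 2 + mode_odd (b t) 2 ^+ 2)))
   (fun t => (slack_size (b t) + `|b t| ^+ 2) * `|b t|).
Proof.
have [[x0 x1 z0 y1] [u v]] := linear_modes_slack.
have M1 := dominated_mode_one; have Mm := dominated_mode_minus.
have Me := dominated_mode_even; have Mo := dominated_mode_odd.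
have vd i j : vdominated F (fun t => displacement (b t) i - displacement (b t) j)
    (fun t => `|b t|) by apply: vdominatedB; exact: vdominated_displacement.
have cub : dominated F (fun t => vol (displacement (b t)))
    (fun t => (S t + `|b t| ^+ 2) * `|b t|).
  apply: dominated_ler (dominated_triple FF (vd 0 3) (vd 1 3) (vd 2 3)).
  apply: nearW => t; rewrite mulrA -expr2 ler_wpM2r // lerDr.
  by apply: sumr_ge0 => n _; rewrite !addr_ge0.
have quad f g : dominated F f S -> dominated F g (fun t => `|b t|) ->
    dominated F (fun t => f t * g t) (fun t => (S t + `|b t| ^+ 2) * `|b t|).
  move=> fS gr; apply: dominated_ler (dominatedM FF fS gr).
  by apply: nearW => t; rewrite ler_wpM2r // lerDl sqr_ge0.
apply: (dominated_eq (f1 := fun t =>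
  (mode_one (b t) 0 * (- ((1 + s) / 2) * mode_one (b t) 0 - (1 + s) * mode_one (b t) 2)
     + mode_one (b t) 2 * ((1 - s) * mode_one (b t) 1)
     + mode_minus (b t) 0 * ((1 + s) / 2 * mode_minus (b t) 0)
     + mode_minus (b t) 1 * ((1 + s) / 2 * mode_minus (b t) 1)
     + (mode_even (b t) 0 + mode_odd (b t) 1 + mode_even (b t) 2)
         * ((1 + s) * mode_even (b t) 2 + (s - 1) * mode_odd (b t) 2)
     + (mode_odd (b t) 0 - mode_even (b t) 1 + mode_odd (b t) 2)
         * ((1 - s) * mode_even (b t) 2 + (1 + s) * mode_odd (b t) 2))
  - vol (displacement (b t)))).
  by move=> t; rewrite slack_identity; ring.
apply: (dominatedB FF) => //.
by do 5?[apply: dominatedD => //]; apply: quad => //;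
  do ?[apply: dominatedB | apply: dominatedD]; apply: dominatedZ.
Qed.

(** The first three terms are the coordinates in which the quadratic form of
    [slack_identity] is definite, and the square of the norm makes room for the
    nonlinear part of the facet slacks. *)
Let E := fun t => `|mode_one (b t) 1| + `|mode_even (b t) 2| + `|mode_odd (b t) 2|
  + slack_size (b t) + `|b t| ^+ 2.

Lemma slack_size_ge0 (M : 'M[R]_(4, 3)) : 0 <= slack_size M.
Proof. by apply: sumr_ge0 => n _; rewrite !addr_ge0. Qed.

(** Inverse discrete Fourier transform. *)
Lemma fourier_inversion k (M : 'M[R]_(4, 3)) :
  [/\ M 0 k = 4^-1 * (mode_one M k + mode_minus M k) + 2^-1 * mode_even M k,
      M 1 k = 4^-1 * (mode_one M k - mode_minus M k) + 2^-1 * mode_odd M k,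
      M 2 k = 4^-1 * (mode_one M k + mode_minus M k) - 2^-1 * mode_even M k &
      M 3 k = 4^-1 * (mode_one M k - mode_minus M k) - 2^-1 * mode_odd M k].
Proof. by rewrite /mode_one /mode_minus /mode_even /mode_odd; split; field. Qed.

(** The slacks, together with the three coordinates of the quadratic form,
    determine all of [b] to first order.  The diagonal and side slacks give six
    of the Fourier coordinates or sums of them; the alternating sum of the facet
    slacks then gives [mode_minus b 2], and the differences of opposite facet
    slacks give a 2 x 2 system for [mode_even b 0] and [mode_odd b 0]. *)
Lemma dominated_entries_gauge : dominated F (fun t => `|b t|) E.
Proof.
have E0 t : [/\ 0 <= `|mode_one (b t) 1|, 0 <= `|mode_even (b t) 2|,
    0 <= `|mode_odd (b t) 2|, 0 <= slack_size (b t) & 0 <= `|b t| ^+ 2].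
  by split => //; exact: slack_size_ge0.
have domE f g : dominated F f g -> (forall t, g t <= E t) -> dominated F f E.
  by move=> fg gE; apply: dominated_ler fg; exact: nearW.
have y0 : dominated F (fun t => mode_one (b t) 1) E.
  by apply: domE (dominated_refl FF _) _ => t; have [] := E0 t; rewrite /E; lra.
have za : dominated F (fun t => mode_even (b t) 2) E.
  by apply: domE (dominated_refl FF _) _ => t; have [] := E0 t; rewrite /E; lra.
have zb : dominated F (fun t => mode_odd (b t) 2) E.
  by apply: domE (dominated_refl FF _) _ => t; have [] := E0 t; rewrite /E; lra.
have SE f : dominated F f (fun t => slack_size (b t)) -> dominated F f E.
  by move=> fS; apply: domE fS _ => t; have [] := E0 t; rewrite /E; lra.
have rE f : dominated F f (fun t => `|b t| ^+ 2) -> dominated F f E.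
  by move=> fr; apply: domE fr _ => t; have [] := E0 t; rewrite /E; lra.
have [[/SE x0 /SE x1 /SE z0 /SE y1] [/SE u /SE v]] := linear_modes_slack.
have lin n : dominated F (fun t => facet_linear (b t) n) E.
  have [_ _ /SE hn] := dominated_slack n.
  apply: dominated_eq (dominatedB FF hn (rE _ (dominated_facet_taylor n))) => t.
  by rewrite opprB addrC subrK.
have [s_lb s_ub] := andP (sqrt2_bounds R).
have D f g := @dominatedD R T F FF f g E.
have B f g := @dominatedB R T F FF f g E.
have Z c f := @dominatedZ R T F FF c f E.
have z1 : dominated F (fun t => mode_minus (b t) 2) E.
  apply: (@dominatedZK _ _ _ FF (16 + 8 * s)); first by rewrite gt_eqF //; lra.
  apply: dominated_eq (D _ _ (D _ _ (B _ _ (lin 0) (lin 1)) (B _ _ (lin 2) (lin 3)))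
     (Z (8 + 4 * s) _ (D _ _ x1 y1))) => t.
  rewrite /facet_linear !addI4E /mode_minus; ring.
(* P and Q are [mode_even b 0 + mode_odd b 1] and [mode_odd b 0 - mode_even b 1]. *)
have P := B _ _ u za; have Q := B _ _ v zb.
(* Dividing by 8 and using P and Q to eliminate [mode_odd b 1] and
   [mode_even b 1], the facet differences become a rotation-like system. *)
have ha : dominated F (fun t => (3 + 2 * s) * mode_even (b t) 0
     + (1 + s) * mode_odd (b t) 0) E.
  apply: (@dominatedZK _ _ _ FF 8); first by rewrite gt_eqF.
  apply: dominated_eq (D _ _ (D _ _ (B _ _ (lin 0) (lin 2))
     (D _ _ (Z (4 + 2 * s) _ Q) (Z (16 + 10 * s) _ P)))
     (B _ _ (Z (4 + 4 * s) _ za) (Z 4 _ zb))) => t.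
  rewrite /facet_linear !addI4E /mode_even /mode_odd; ring.
have hb : dominated F (fun t => - (1 + s) * mode_even (b t) 0
     + (3 + 2 * s) * mode_odd (b t) 0) E.
  apply: (@dominatedZK _ _ _ FF 8); first by rewrite gt_eqF.
  apply: dominated_eq (D _ _ (D _ _ (B _ _ (lin 1) (lin 3))
     (B _ _ (Z (16 + 10 * s) _ Q) (Z (4 + 2 * s) _ P)))
     (D _ _ (Z 4 _ za) (Z (4 + 4 * s) _ zb))) => t.
  rewrite /facet_linear !addI4E /mode_even /mode_odd; ring.
have det0 : (3 + 2 * s) ^+ 2 + (1 + s) ^+ 2 != 0 by rewrite gt_eqF //; nra.
have xa : dominated F (fun t => mode_even (b t) 0) E.
  apply: (dominatedZK FF det0).
  apply: dominated_eq (B _ _ (Z (3 + 2 * s) _ ha) (Z (1 + s) _ hb)) => t; ring.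
have xb : dominated F (fun t => mode_odd (b t) 0) E.
  apply: (dominatedZK FF det0).
  apply: dominated_eq (D _ _ (Z (1 + s) _ ha) (Z (3 + 2 * s) _ hb)) => t; ring.
have yb : dominated F (fun t => mode_odd (b t) 1) E.
  by apply: dominated_eq (B _ _ P xa) => t; ring.
have ya : dominated F (fun t => mode_even (b t) 1) E.
  by apply: dominated_eq (B _ _ xb Q) => t; ring.
have entries n k : dominated F (fun t => b t n k) E.
  have modes : [/\ dominated F (fun t => mode_one (b t) k) E,
      dominated F (fun t => mode_minus (b t) k) E,
      dominated F (fun t => mode_even (b t) k) E &
      dominated F (fun t => mode_odd (b t) k) E].
    by move: k; apply: I3_ind; split.
  have [m0 m1 ma mb] := modes.
  move: n; apply: I4_ind.
  - apply: dominated_eq (D _ _ (Z 4^-1 _ (D _ _ m0 m1)) (Z 2^-1 _ ma)) => t.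
    by have [<-] := fourier_inversion k (b t).
  - apply: dominated_eq (D _ _ (Z 4^-1 _ (B _ _ m0 m1)) (Z 2^-1 _ mb)) => t.
    by have [_ <-] := fourier_inversion k (b t).
  - apply: dominated_eq (B _ _ (Z 4^-1 _ (D _ _ m0 m1)) (Z 2^-1 _ ma)) => t.
    by have [_ _ <-] := fourier_inversion k (b t).
  - apply: dominated_eq (B _ _ (Z 4^-1 _ (B _ _ m0 m1)) (Z 2^-1 _ mb)) => t.
    by have [_ _ _ <-] := fourier_inversion k (b t).
have [K K0 bK] : dominated F (fun t => \sum_n \sum_k `|b t n k|) E.
  by apply: (dominated_sum FF) => n; apply: (dominated_sum FF) => k; exact: dominated_norm.
exists K => //; apply: filterS bK => t; apply: le_trans.
rewrite normr_id ger0_norm; first exact: mx_norm_le_sum.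
by apply: sumr_ge0 => n _; apply: sumr_ge0.
Qed.

Lemma dominated_slack_size : dominated F (fun t => slack_size (b t)) (fun t => `|b t|).
Proof.
apply: (dominated_sum FF) => n; have en i j := dominated_entry i j.
apply: (dominatedD FF); [apply: (dominatedD FF)|]; apply: dominated_norm => //.
- exact: dominatedD.
- by apply: dominatedD => //; apply: dominatedD => //;
    do ?[apply: dominatedB|apply: dominatedD].
- have lin : dominated F (fun t => facet_linear (b t) n) (fun t => `|b t|).
    by do ?[apply: dominatedB|apply: dominatedD]; apply: dominatedZ.
  have r2 : dominated F (fun t => facet_slack (b t) n - facet_linear (b t) n)
      (fun t => `|b t|).
    apply: dominated_ler (dominated_facet_taylor n); apply: filterS b1 => t bt.
    by rewrite expr2 ler_piMl.
  by apply: dominated_eq (dominatedD FF r2 lin) => t; rewrite subrK.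
Qed.

End Remainders.

(** * Rigidity *)

(** Substituting [Q <= - A + K (A + r^2) r] in the bound for [r^2] makes [A] occur
    with coefficient about [- K], and every other term carries a factor [r]
    that is small against [A] or against [r^2]. *)
Lemma absorb_small_radius (K r A Q : R) :
  1 <= K -> 0 <= r -> K ^+ 2 * r <= 8^-1 -> 0 <= A ->
  A <= K * r -> A <= - Q + K * ((A + r ^+ 2) * r) ->
  r ^+ 2 <= K * (Q + A ^+ 2 + (r ^+ 2) ^+ 2) -> r = 0.
Proof.
move=> K1 r0 Kr A0 AKr AQ rQ.
have r1 : K * r <= 8^-1.
  by apply: le_trans Kr; rewrite ler_wpM2r // expr2 ler_peMr //; lra.
have r1' : r <= 8^-1 by apply: le_trans r1; rewrite ler_peMl.
have h1 : K * A <= - (K * Q) + (K ^+ 2 * r) * A + (K ^+ 2 * r) * r ^+ 2.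
  have : K * A <= K * (- Q + K * ((A + r ^+ 2) * r)) by rewrite ler_wpM2l //; lra.
  lra.
have h2 : (K ^+ 2 * r) * A <= 8^-1 * A by rewrite ler_wpM2r.
have h3 : (K ^+ 2 * r) * r ^+ 2 <= 8^-1 * r ^+ 2 by rewrite ler_wpM2r // sqr_ge0.
have h4 : K * A ^+ 2 <= (K ^+ 2 * r) * A.
  have : K * A * A <= K * A * (K * r) by rewrite ler_wpM2l // mulr_ge0 //; lra.
  lra.
have h5 : K * (r ^+ 2) ^+ 2 <= 8^-1 * r ^+ 2.
  have -> : K * (r ^+ 2) ^+ 2 = (K * r) * r * r ^+ 2 by ring.
  rewrite ler_wpM2r ?sqr_ge0 //; apply: le_trans r1; rewrite ler_piMr ?mulr_ge0 //; lra.
have h6 : A <= K * A by rewrite ler_peMl.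
have : r ^+ 2 <= 0 by lra.
by move=> /(conj (sqr_ge0 r)) /andP /le_anti /esym /eqP; rewrite sqrf_eq0 => /eqP.
Qed.

Lemma sqr_sum5_le (a b c d e : R) :
  (a + b + c + d + e) ^+ 2 <= 5 * (a ^+ 2 + b ^+ 2 + c ^+ 2 + d ^+ 2 + e ^+ 2).
Proof.
have := sqr_ge0 (a - b); have := sqr_ge0 (a - c); have := sqr_ge0 (a - d).
have := sqr_ge0 (a - e); have := sqr_ge0 (b - c); have := sqr_ge0 (b - d).
have := sqr_ge0 (b - e); have := sqr_ge0 (c - d); have := sqr_ge0 (c - e).
have := sqr_ge0 (d - e); lra.
Qed.

Lemma slacks_ge0_trivial : \forall b \near (0 : 'M[R]_(4, 3)),
  (forall n, [/\ 0 <= diagonal_slack b n, 0 <= side_slack b n & 0 <= facet_slack b n]) ->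
  b = 0.
Proof.
have FF := nbhs_filter (0 : 'M[R]_(4, 3)).
have near_le e : 0 < e -> \forall b \near (0 : 'M[R]_(4, 3)), `|b| <= e.
  by move=> e0; apply/nbhs_norm0P; exists e => //= b /ltW.
have b1 := near_le 1 ltr01.
have [K1 K10 N1] := weighted_slack_expansion FF id; rewrite /= in N1.
have [K2 K20 N2] := dominated_entries_gauge FF (b := id) b1; rewrite /= in N2.
have [K3 K30 N3] := dominated_slack_size FF (b := id) b1; rewrite /= in N3.
pose K := 1 + K1 + 5 * K2 ^+ 2 + K3.
have K2sq := sqr_ge0 K2.
have KK : 1 <= K by rewrite /K; lra.
have e0 : 0 < (8 * K ^+ 2)^-1 by rewrite invr_gt0 mulr_gt0 // exprn_gt0 //; lra.
have N4 := near_le _ e0.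
have [s_lb s_ub] := andP (sqrt2_bounds R).
apply: filterS (filterI (filterI N1 N2) (filterI N3 N4)) => b [[n1 n2] [n3 n4]] pos.
set A := slack_size b in n1 n2 n3.
set r := `|b| in n1 n2 n3 n4.
have r0 : 0 <= r by exact: normr_ge0.
have A0 : 0 <= A by exact: slack_size_ge0.
set y0 := mode_one b 1 in n1 n2; set za := mode_even b 2 in n1 n2.
set zb := mode_odd b 2 in n1 n2.
have AL : A <= \sum_n (4 * s * diagonal_slack b n + 4 * side_slack b n + facet_slack b n).
  apply: ler_sum => n _; have [d0 e0' f0] := pos n.
  rewrite !ger0_norm // lerD2r lerD //; last by rewrite ler_peMl //; lra.
  by rewrite ler_peMl //; lra.
have y2 := sqr_ge0 y0; have za2 := sqr_ge0 za; have zb2 := sqr_ge0 zb.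
have r2 := sqr_ge0 r; have r4 := sqr_ge0 (r ^+ 2).
have AQ : A <= - (y0 ^+ 2 + za ^+ 2 + zb ^+ 2) + K * ((A + r ^+ 2) * r).
  have Ar : 0 <= (A + r ^+ 2) * r by rewrite mulr_ge0 // addr_ge0.
  have : K1 * ((A + r ^+ 2) * r) <= K * ((A + r ^+ 2) * r) by rewrite ler_wpM2r // /K; lra.
  have s1 : 0 <= s - 1 by lra.
  have := mulr_ge0 s1 y2; have := mulr_ge0 s1 za2; have := mulr_ge0 s1 zb2.
  move: n1; rewrite ler_norml => /andP[_]; lra.
have rQ : r ^+ 2 <= K * (y0 ^+ 2 + za ^+ 2 + zb ^+ 2 + A ^+ 2 + (r ^+ 2) ^+ 2).
  set Q := y0 ^+ 2 + za ^+ 2 + zb ^+ 2 + A ^+ 2 + (r ^+ 2) ^+ 2.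
  have : r ^+ 2 <= (K2 * (`|y0| + `|za| + `|zb| + A + r ^+ 2)) ^+ 2.
    rewrite ler_sqr ?nnegrE //; last by rewrite mulr_ge0 // !addr_ge0.
    by move: n2; rewrite normr_id.
  move=> /le_trans; apply; rewrite exprMn.
  apply: (@le_trans _ _ (K2 ^+ 2 * (5 * Q))); last first.
    by rewrite mulrA [_ * 5]mulrC ler_wpM2r // /Q /K; [rewrite !addr_ge0 ?sqr_ge0 | lra].
  rewrite ler_wpM2l // /Q -(real_normK (num_real y0)) -(real_normK (num_real za)).
  by rewrite -(real_normK (num_real zb)) sqr_sum5_le.
have Kr : K ^+ 2 * r <= 8^-1.
  have K8 : 0 < 8 * K ^+ 2 by rewrite mulr_gt0 // exprn_gt0 //; lra.
  have : (8 * K ^+ 2) * r <= 1 by rewrite -ler_pdivlMl // mulr1.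
  lra.
have AKr : A <= K * r.
  move: n3; rewrite ger0_norm // => /le_trans; apply; rewrite ler_wpM2r // /K; lra.
apply: normr0_eq0; exact: absorb_small_radius KK r0 Kr A0 AKr AQ rQ.
Qed.

Lemma iter_rot4 n (v : 'rV[R]_3) : (n <= 4)%N ->
  iter n (@rot R) (iter (4 - n) (@rot R) v) = v.
Proof.
move=> n4; rewrite -iterD subnKC //=.
by apply: row3_eq; rewrite /rot !point3E ?opprK.
Qed.

Lemma euclidean_norm_rot (v : 'rV[R]_3) : euclidean_norm (rot v) = euclidean_norm v.
Proof.
congr Num.sqrt; rewrite !big_ord_recl !big_ord0 !mxE /= !addr0 !sqrrN addrCA.
by do ![congr (_ + _)]; congr (v _ _ ^+ 2); apply: val_inj.
Qed.

Lemma entry_le_euclidean_norm n (v : 'rV[R]_n) k : `|v 0 k| <= euclidean_norm v.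
Proof.
rewrite -sqrtr_sqr ler_sqrt; last by apply: sumr_ge0 => i _; exact: sqr_ge0.
by rewrite (bigD1 k) //= lerDl; apply: sumr_ge0 => i _; exact: sqr_ge0.
Qed.

(** Undoing the rotations shows that [vertex] parametrizes all quadruples of
    points; they are isometries, so closeness is preserved. *)
Lemma vertex_chart (a : 'I_4 -> 'rV[R]_3) (eps : R) : 0 < eps ->
  (forall i, euclidean_norm (a i - Delta_vertex R i) < eps) ->
  exists2 b : 'M[R]_(4, 3), `|b| < eps & a = vertex b.
Proof.
move=> eps0 aeps; pose v (n : 'I_4) : 'rV[R]_3 :=
  iter (4 - n) (@rot R) (a n - Delta_vertex R n).
exists (\matrix_n v n).
  rewrite [ltLHS]/Num.Def.normr /= mx_normrE; apply: bigmax_lt => // -[n k] _ /=.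
  have vE m u : euclidean_norm (iter m (@rot R) u) = euclidean_norm u.
    by elim: m => //= m <-; rewrite euclidean_norm_rot.
  rewrite mxE; apply: le_lt_trans (entry_le_euclidean_norm _ _) _.
  by rewrite vE.
apply: funext => n; rewrite vertexD /displacement rowK iter_rot4 ?[(n <= 4)%N]ltnW //.
by rewrite addrC subrK.
Qed.

End Rigidity.

Theorem theorem1p2 (R : realType) :
  [/\ affinely_independent (Delta_vertex R),
      hollow (Lambda R) (Delta R),
      lattice_width (Lambda R) (Delta R) = 2 + Num.sqrt 2
    & exists2 eps : R, 0 < eps &
        forall a' : 'I_4 -> 'rV[R]_3,
          affinely_independent a' ->
          (forall i, euclidean_norm (a' i - Delta_vertex R i) < eps) ->
          convex_hull a' <> Delta R ->
          ~ hollow (Lambda R) (convex_hull a') \/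
          lattice_width (Lambda R) (convex_hull a') < 2 + Num.sqrt 2].
Proof.
split; [exact: Delta_vertex_free | exact: hollow_Delta | exact: lattice_width_Delta |].
have : \forall b \near (0 : 'M[R]_(4, 3)),
    hollow (Lambda R) (convex_hull (vertex b)) ->
    2 + Num.sqrt 2 <= lattice_width (Lambda R) (convex_hull (vertex b)) -> b = 0.
  apply: filterS2 (near_slacks_ge0 R) (slacks_ge0_trivial R) => b slacks trivial hb wb.
  exact: trivial (slacks hb wb).
move=> /nbhs_norm0P[eps /= eps0 rigid]; exists eps => // a' _ a'eps a'D.
have [b beps a'E] := vertex_chart eps0 a'eps.
have [hb|] := pselect (hollow (Lambda R) (convex_hull a')); last by left.
right; rewrite ltNge; apply/negP => wb; apply: a'D.
rewrite a'E in hb wb *.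
by rewrite (rigid b beps hb wb) vertex0.
Qed.
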